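(* Let $t=[0,a_1,a_2,\dots]$ be the irrational number in $(0,1)$ whose regular continued fraction has partial quotients $a_i$, where $a_i$ is the integer consisting of a tower of $i$ twos with an $i$ on top; that is, $a_1=2^1=2$, $a_2=2^{2^2}$, $a_3=2^{2^{2^3}}$, and so on. Let $y=\exp(2\pi i t)$. Then $K(y)$ does not converge generally.
   Context: The tower can be described as $a_i=T_i(i)$, where $T_0(z)=z$ and $T_{j+1}(z)=2^{T_j(z)}$. For $x\in\mathbb{C}$, $K(x)$ is the continued fraction $$K(x)=1+\cfrac{x}{1+\cfrac{x^2}{1+\cfrac{x^3}{1+\ddots}}}.$$ Its $n$-th convergent is $P_n(x)/Q_n(x)$, where $P_0=1$, $P_1=1+x$, $Q_0=Q_1=1$, and $P_{n+1}(x)=P_n(x)+x^{n+1}P_{n-1}(x)$, $Q_{n+1}(x)=Q_n(x)+x^{n+1}Q_{n-1}(x)$ for $n\ge1$. Let $\hat{\mathbb{C}}=\mathbb{C}\cup\{\infty\}$, with the chordal metric $d(w,z)=\dfrac{|z-w|}{\sqrt{1+|w|^2}\sqrt{1+|z|^2}}$ for finite $w,z$, $d(w,\infty)=\dfrac{1}{\sqrt{1+|w|^2}}$ for finite $w$, and $d(\infty,\infty)=0$. For a continued fraction $b_0+\cfrac{\alpha_1}{b_1+\cfrac{\alpha_2}{b_2+\ddots}}$ with $n$-th convergent $A_n/B_n$, put $$S_n(w)=b_0+\cfrac{\alpha_1}{b_1+\ddots+\cfrac{\alpha_n}{b_n+w}}=\frac{A_n+wA_{n-1}}{B_n+wB_{n-1}},\qquad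 S_n(\infty)=\frac{A_{n-1}}{B_{n-1}}.$$ The continued fraction converges generally to $f\in\hat{\mathbb{C}}$ if there exist sequences $\{v_n\},\{w_n\}\subset\hat{\mathbb{C}}$ with $\liminf_{n\to\infty} d(v_n,w_n)>0$ and $\lim_{n\to\infty}S_n(v_n)=\lim_{n\to\infty}S_n(w_n)=f$. It converges generally if it converges generally to some $f\in\hat{\mathbb{C}}$. *)

(* Defs.v *)
From mathcomp Require Import all_boot all_order all_algebra.
From mathcomp Require Import all_classical all_reals all_analysis.
From mathcomp Require Import complex.

Set Implicit Arguments.
Unset Strict Implicit.
Unset Printing Implicit Defensive.

Import Order.TTheory GRing.Theory Num.Theory.
Import numFieldNormedType.Exports.

Local Open Scope classical_set_scope.
Local Open Scope ring_scope.

(* Fundamental recurrence of the continued fraction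
     b 0 + al 1 / (b 1 + al 2 / (b 2 + ...))
   (the value al 0 is never used).  The index is shifted by one so that the
   initial values of index -1 are available:
     cf_num al b n = A_(n-1)   with A_(-1) = 1, A_0 = b 0,
     cf_den al b n = B_(n-1)   with B_(-1) = 0, B_0 = 1. *)
Fixpoint cf_rec (F : fieldType) (al b : nat -> F) (u0 u1 : F) (n : nat) : F :=
  match n with
  | 0 => u0
  | m.+1 =>
    match m with
    | 0 => u1
    | k.+1 => b m * cf_rec al b u0 u1 m + al m * cf_rec al b u0 u1 k
    end
  end.

Definition cf_num (F : fieldType) (al b : nat -> F) : nat -> F :=
  cf_rec al b 1 (b 0%N).

Definition cf_den (F : fieldType) (al b : nat -> F) : nat -> F :=
  cf_rec al b 0 1.

(* t = [a 0, a 1, a 2, ...] as the limit of the convergents A_n / B_n; the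
   positivity clause makes B_n > 0, so the quotient is genuine. *)
Definition has_regular_cf (R : realType) (a : nat -> nat) (t : R) : Prop :=
  (forall i, (0 < i)%N -> (0 < a i)%N) /\
  (fun n => cf_num (fun=> 1) (fun i => (a i)%:R) n.+1 /
            cf_den (fun=> 1) (fun i => (a i)%:R) n.+1 : R) @ \oo --> t.

Fixpoint tower (j z : nat) : nat :=
  if j is i.+1 then (2 ^ tower i z)%N else z.

(* i twos with an i on top; the value at 0 is the integer part of t. *)
Definition tower_quotient (i : nat) : nat := if i is 0 then 0%N else tower i i.

Definition expc (R : realType) (z : R[i]) : R[i] :=
  ((expR (complex.Re z))%:C * (cos (complex.Im z) +i* sin (complex.Im z)))%C.

(* The extended complex plane; None is the point at infinity. *)
Definition Chat (R : realType) : Type := option R[i].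

Definition chordal (R : realType) (w z : Chat R) : R :=
  let h (u : R[i]) := Num.sqrt (1 + Normc.normc u ^+ 2) in
  match w, z with
  | Some w, Some z => Normc.normc (z - w) / (h w * h z)
  | Some w, None => (h w)^-1
  | None, Some z => (h z)^-1
  | None, None => 0
  end.

(* Quotient in the extended plane.  The convention p / 0 = oo is only relevant
   for p != 0 when all partial numerators are nonzero: then
   A_n B_(n-1) - A_(n-1) B_n != 0, so 0 / 0 does not occur in cf_S. *)
Definition Chat_div (R : realType) (p q : R[i]) : Chat R :=
  if q == 0 then None else Some (p / q).

Definition cf_S (R : realType) (al b : nat -> R[i]) (n : nat) (w : Chat R) :
    Chat R :=
  match w with
  | Some w => Chat_div (cf_num al b n.+1 + w * cf_num al b n)
                       (cf_den al b n.+1 + w * cf_den al b n)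
  | None => Chat_div (cf_num al b n) (cf_den al b n)
  end.

Definition Chat_cvg (R : realType) (u : nat -> Chat R) (f : Chat R) : Prop :=
  (fun n => chordal (u n) f) @ \oo --> (0 : R).

Definition converges_generally_to (R : realType) (al b : nat -> R[i])
    (f : Chat R) : Prop :=
  exists v w : nat -> Chat R,
    [/\ (0 < limn_einf (fun n => (chordal (v n) (w n))%:E))%E,
        Chat_cvg (fun n => cf_S al b n (v n)) f &
        Chat_cvg (fun n => cf_S al b n (w n)) f].

Definition converges_generally (R : realType) (al b : nat -> R[i]) : Prop :=
  exists f : Chat R, converges_generally_to al b f.

(* K(x) = 1 + x / (1 + x^2 / (1 + x^3 / (1 + ...))) *)
Definition K_num (R : realType) (x : R[i]) (n : nat) : R[i] := x ^+ n.
Definition K_den (R : realType) (n : nat) : R[i] := 1.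

Definition K_converges_generally (R : realType) (x : R[i]) : Prop :=
  converges_generally (K_num x) (@K_den R).

(* The convergents P_n / Q_n of K(x) satisfy the expected recurrences. *)
Section KConvergents.
Context (R : realType) (x : R[i]).

Definition K_P (n : nat) : R[i] := cf_num (K_num x) (@K_den R) n.+1.
Definition K_Q (n : nat) : R[i] := cf_den (K_num x) (@K_den R) n.+1.

Fact K_P0 : K_P 0 = 1. Proof. by []. Qed.
Fact K_P1 : K_P 1 = 1 + x.
Proof. by rewrite /K_P /cf_num /= /K_den /K_num expr1 !mulr1. Qed.
Fact K_Q0 : K_Q 0 = 1. Proof. by []. Qed.
Fact K_Q1 : K_Q 1 = 1.
Proof. by rewrite /K_Q /cf_den /= /K_den mulr1 mulr0 addr0. Qed.
Fact K_PS (n : nat) : K_P n.+2 = K_P n.+1 + x ^+ n.+2 * K_P n.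
Proof. by rewrite {1}/K_P /cf_num /= -/(cf_num _ _) /K_den mul1r. Qed.
Fact K_QS (n : nat) : K_Q n.+2 = K_Q n.+1 + x ^+ n.+2 * K_Q n.
Proof. by rewrite {1}/K_Q /cf_den /= -/(cf_den _ _) /K_den mul1r. Qed.

End KConvergents.

(* Main.v *)
Require Import Defs.
From mathcomp Require Import all_boot all_order all_algebra.
From mathcomp Require Import all_classical all_reals all_analysis.
From mathcomp Require Import complex.
From mathcomp Require Import ring lra zify.

(** Write c_n / d_n for the convergents of t, P_N / Q_N for those of K, and fix
    an n with 5 | d_n.  Then x = exp (2 pi i c_n / d_n) is a root of unity whose
    order d = d_n is divisible by 5, and these are the exceptional roots of unity
    of Schur: over one period of length d the vectors (P_(N-1), P_N) and
    (Q_(N-1), Q_N) are just multiplied by scalars p and q (K_prim_root), where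
    |p| = 2 |cos (pi c_n / 5)| and |q| = 2 |cos (3 pi c_n / 5)|.  One of these
    moduli is the golden ratio and the other one is its inverse; which one is
    which depends only on whether c_n is 1, 4 or 2, 3 modulo 5.  So after k
    periods P is huge and Q tiny at x, or the other way round.

    Since a_(n+1) is enormous compared with d_n, the point y = exp (2 pi i t) is
    so close to x that P_N and Q_N hardly change between x and y for N up to
    n d_n (Krec_perturb, regular_cf_approx, conv_den_tower).  When P is huge and Q
    small, S_N maps all of the sphere outside a tiny disc close to infinity, so a
    general limit can only be infinity; when Q is huge and P small it can only
    be 0 (not_general_limit).  Because a_0 = 0, a_1 = 2 and a_i = 1 modulo 5 from
    then on, c_n and d_n run through Fibonacci-like sequences modulo 5: for
    n = 5 k + 3 one has 5 | d_n, and the class of c_n alternates between the two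
    kinds with the parity of k (conv_mod5_cycle).  Both situations occur
    infinitely often, and no general limit is left.

    The periods are computed from Schur's closed form of P_N and Q_N as
    alternating sums of Gaussian binomial coefficients (schur_rec): at a primitive
    m-th root of unity all coefficients of index m, except the two outer ones,
    vanish. *)

Set Implicit Arguments.
Unset Strict Implicit.
Unset Printing Implicit Defensive.

Import Order.TTheory GRing.Theory Num.Theory.
Import numFieldNormedType.Exports.
Import Normc.

Local Open Scope classical_set_scope.
Local Open Scope ring_scope.

(* Keeps normc 0 and normc 1 folded, so that normc0 and normc1 apply. *)
Arguments normc : simpl never.

(** * Gaussian binomial coefficients and Schur's identity *)

Section Schur.
Context (F : fieldType) (q : F).

Fixpoint qbin (n k : nat) : F :=
  match n, k with
  | _, 0 => 1
  | 0, _.+1 => 0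
  | n'.+1, k'.+1 => qbin n' k' + q ^+ k * qbin n' k
  end.

Lemma qbin0 n : qbin n 0 = 1. Proof. by case: n. Qed.

Lemma qbinS n k : qbin n.+1 k.+1 = qbin n k + q ^+ k.+1 * qbin n k.+1.
Proof. by []. Qed.

Arguments qbin : simpl never.

Lemma qbin_small n k : (n < k)%N -> qbin n k = 0.
Proof.
elim: n k => [|n IHn] [|k] // ltnk.
by rewrite qbinS !IHn ?mulr0 ?addr0 // ltnW.
Qed.

Lemma qbinn n : qbin n n = 1.
Proof. by elim: n => // n; rewrite qbinS => ->; rewrite qbin_small // mulr0 addr0. Qed.

(** The mirror image, under k |-> n - k, of the defining Pascal rule. *)
Lemma qbinS_sym n k : (k <= n)%N ->
  qbin n.+1 k.+1 = qbin n k.+1 + q ^+ (n - k) * qbin n k.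
Proof.
elim: n k => [|n IHn] [|k] lekn //.
- by rewrite qbinS qbinn qbin_small // mulr0 mul1r addr0 add0r.
  rewrite [LHS]qbinS [in LHS]IHn // [in RHS]qbinS !qbin0 !subn0 !exprS expr0.
  ring.
rewrite [LHS]qbinS; move: lekn; rewrite ltnS leq_eqVlt => /orP[/eqP ->|ltkn].
  by rewrite !subnn !qbinn qbin_small // mulr0 addr0 add0r mulr1.
rewrite [in LHS](IHn k.+1) // [in LHS](IHn k); last exact: ltnW.
rewrite [in RHS]qbinS [qbin n.+1 k.+1]qbinS subSS.
have -> : q ^+ (n - k) = q ^+ (n - k.+1) * q by rewrite -exprSr subnSK.
rewrite !exprS; ring.
Qed.

(** Comparing the two Pascal rules gives the quotient of neighbours in a row. *)
Lemma qbin_ratio n k : (k <= n)%N ->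
  (1 - q ^+ k.+1) * qbin n k.+1 = (1 - q ^+ (n - k)) * qbin n k.
Proof.
move=> lekn; have := qbinS n k; rewrite qbinS_sym // => /eqP.
rewrite -subr_eq0 => /eqP E; apply/eqP; rewrite -subr_eq0 -E; apply/eqP; ring.
Qed.

(** By qbin_ratio the vanishing of 1 - q^m in the first step propagates along
    the row, as long as 1 - q^k can be cancelled. *)
Lemma qbin_prim_root m k : m.-primitive_root q -> (0 < k < m)%N -> qbin m k = 0.
Proof.
move=> qm; elim: k => [|k IHk] // /andP[_ ltkm].
have E := qbin_ratio (ltnW (ltnW ltkm)).
have nz : 1 - q ^+ k.+1 != 0.
  by rewrite subr_eq0 eq_sym -(prim_order_dvd qm) gtnNdvd.
apply: (mulfI nz); rewrite mulr0 E.
clear E nz; case: k IHk ltkm => [|k] IHk ltkm.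
  by rewrite subn0 (prim_expr_order qm) subrr mul0r.
by rewrite IHk ?mulr0 //=; exact: ltnW.
Qed.

(** Row n of the Gaussian triangle as a linear functional: in this form the two
    Pascal rules act on the weight g, and no sum has to be reindexed. *)
Definition qsum n (g : nat -> F) := \sum_(k < n.+1) qbin n k * g k.

Lemma eq_qsum n g h : (forall k, (k <= n)%N -> g k = h k) -> qsum n g = qsum n h.
Proof. by move=> gh; apply: eq_bigr => k _; rewrite gh // -ltnS. Qed.

Lemma qsumD n g h : qsum n (fun k => g k + h k) = qsum n g + qsum n h.
Proof. by rewrite -big_split; apply: eq_bigr => k _; rewrite mulrDr. Qed.

Lemma qsumZ n a g : qsum n (fun k => a * g k) = a * qsum n g.
Proof. by rewrite mulr_sumr; apply: eq_bigr => k _; rewrite mulrCA. Qed.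

Lemma qsumS n g : qsum n.+1 g = qsum n (fun k => q ^+ k * g k + g k.+1).
Proof.
rewrite qsumD /qsum big_ord_recl /= [X in _ = X + _]big_ord_recl /= !qbin0.
rewrite expr0 !mul1r -addrA; congr (_ + _).
under eq_bigr => k _ do rewrite /bump /= add1n qbinS mulrDl.
rewrite big_split addrC /=; congr (_ + _).
rewrite big_ord_recr /= qbin_small // mulr0 mul0r addr0.
by apply: eq_bigr => k _; rewrite /bump /= add1n; ring.
Qed.

Lemma qsumS_sym n g :
  qsum n.+1 g = qsum n (fun k => g k + q ^+ (n - k) * g k.+1).
Proof.
rewrite qsumD /qsum big_ord_recl /= [X in _ = X + _]big_ord_recl /= !qbin0.
rewrite !mul1r -addrA; congr (_ + _).
under eq_bigr => k _ do rewrite /bump /= add1n (qbinS_sym (leq_ord k)) mulrDl.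
rewrite big_split /=; congr (_ + _).
  by rewrite big_ord_recr /= qbin_small // mul0r addr0.
by apply: eq_bigr => k _; ring.
Qed.

Lemma qsum_prim_root m g : m.-primitive_root q -> qsum m g = g 0%N + g m.
Proof.
case: m => [|m] qm; first by have := prim_order_gt0 qm.
rewrite /qsum big_ord_recr big_ord_recl [qbin _ ord0]qbin0 [qbin _ ord_max]qbinn !mul1r.
rewrite big1 /= ?addr0 // => k _.
by rewrite qbin_prim_root ?mul0r //= /bump add1n /= ltnS ltn_ord.
Qed.

(** The bilateral sum of u i [n; floor ((n - i) / 2)] over all integers i, where
    [n; k] is qbin n k; each k arises from i = n - 2k and from i = n - 2k - 1. *)
Definition schur (u : int -> F) n : F :=
  qsum n (fun k => u (n%:Z - (2 * k)%:Z) + u (n%:Z - (2 * k)%:Z - 1)).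

(** Split the sum by the parity of n - i.  One Pascal rule followed by the other
    reduces both halves to row n, up to the terms wanted and a remainder; the
    remainders of the two halves are supported on indices that differ by 5, and
    the hypothesis on u is exactly what makes them cancel. *)
Lemma schur_rec u : q != 0 -> (forall z, u z = - q ^ (z - 2) * u (z - 5)) ->
  forall n, schur u n.+2 = schur u n.+1 + q ^+ n.+1 * schur u n.
Proof.
move=> q0 hu n.
pose g k := u (n%:Z + 2 - (2 * k)%:Z); pose h k := u (n%:Z + 1 - (2 * k)%:Z).
have E2 : schur u n.+2 = qsum n.+2 g + qsum n.+2 h.
  by rewrite -qsumD; apply: eq_qsum => k _; congr (u _ + u _); lia.
have E1 : schur u n.+1 = qsum n.+1 (fun k => g k.+1) + qsum n.+1 h.
  by rewrite addrC -qsumD; apply: eq_qsum => k _; congr (u _ + u _); lia.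
have E0 : schur u n = qsum n (fun k => g k.+1) + qsum n (fun k => h k.+1).
  by rewrite -qsumD; apply: eq_qsum => k _; congr (u _ + u _); lia.
(* The half with n - i even. *)
have G : qsum n.+2 g =
    qsum n (fun k => q ^+ k * g k) + q ^+ n.+1 * qsum n (fun k => g k.+1)
    + qsum n.+1 (fun k => g k.+1).
  rewrite qsumS qsumD qsumS_sym -qsumZ -qsumD; congr (_ + _).
  apply: eq_qsum => k kn; congr (_ + _); rewrite mulrA -exprD; congr (q ^+ _ * _).
  by lia.
(* The half with n - i odd, with the Pascal rules in the opposite order. *)
have H : qsum n.+2 h = qsum n.+1 h +
    (q ^+ n.+1 * qsum n (fun k => h k.+1) + qsum n (fun k => q ^+ (n - k) * h k.+2)).
  rewrite qsumS_sym qsumD [X in _ + X]qsumS -qsumZ -qsumD; congr (_ + _).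
  apply: eq_qsum => k kn; rewrite subSS mulrA -exprD; congr (q ^+ _ * _ + _).
  by lia.
have C : qsum n (fun k => q ^+ k * g k) + qsum n (fun k => q ^+ (n - k) * h k.+2) = 0.
  rewrite -qsumD (eq_qsum (h := fun=> 0)) => [|k kn].
    by rewrite /qsum big1 // => k _; rewrite mulr0.
  rewrite /g hu; set a := u _; have -> : h k.+2 = a by congr (u _); lia.
  rewrite mulrA mulrN mulNr; apply/eqP; rewrite addrC subr_eq0; apply/eqP.
  rewrite !exprnP -expfzDr //; congr (q ^ _ * _); lia.
move/eqP: C; rewrite addr_eq0 => /eqP C.
by rewrite E2 E1 E0 G H C; ring.
Qed.

Lemma schur0 u : schur u 0 = u 0 + u (-1).
Proof. by rewrite /schur /qsum big_ord1 /= mul1r muln0 subr0 sub0r. Qed.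

Lemma schur1 u : schur u 1 = u 1 + u 0 + u (-1) + u (-2).
Proof.
rewrite /schur qsumS /qsum big_ord1 /= expr0 !mul1r !muln0 muln1 subr0 addrA.
by congr (_ + _ + u _ + u _).
Qed.

Lemma schur_prim_root u m : m.-primitive_root q ->
  schur u m = u m%:Z + u (m%:Z - 1) + u (- m%:Z) + u (- m%:Z - 1).
Proof.
move=> qm; rewrite /schur qsum_prim_root // addrA; congr (u _ + u _ + u _ + u _); lia.
Qed.

Lemma schur_prim_rootS u m : m.-primitive_root q ->
  schur u m.+1 = u (m%:Z + 1) + u m%:Z + u (m%:Z - 1) + u (m%:Z - 2)
   + u (- m%:Z + 1) + u (- m%:Z) + u (- m%:Z - 1) + u (- m%:Z - 2).
Proof.
move=> qm; rewrite /schur qsumS qsum_prim_root // (prim_expr_order qm) expr0 !mul1r !addrA.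
congr (u _ + u _ + u _ + u _ + u _ + u _ + u _ + u _); lia.
Qed.

Lemma two_step_rec_uniq (al f g : nat -> F) : f 0%N = g 0%N -> f 1%N = g 1%N ->
  (forall n, f n.+2 = f n.+1 + al n * f n) ->
  (forall n, g n.+2 = g n.+1 + al n * g n) -> f =1 g.
Proof.
move=> E0 E1 hf hg n; suff: f n = g n /\ f n.+1 = g n.+1 by case.
by elim: n => [|n [IH0 IH1]] //; rewrite hf hg IH0 IH1.
Qed.

Definition Knum := cf_num (fun n => q ^+ n) (fun=> 1).
Definition Kden := cf_den (fun n => q ^+ n) (fun=> 1).

Lemma KnumS n : Knum n.+2 = Knum n.+1 + q ^+ n.+1 * Knum n.
Proof. by rewrite /Knum /cf_num [LHS]/= mul1r. Qed.

Lemma KdenS n : Kden n.+2 = Kden n.+1 + q ^+ n.+1 * Kden n.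
Proof. by rewrite /Kden /cf_den [LHS]/= mul1r. Qed.

End Schur.

(** * K at roots of unity of order divisible by 5 *)

Section Theta.
Context (F : fieldType) (r : F).

(** The solution, supported on s + 5 Z, of the recurrence that schur_rec asks of
    u, for q = r^2.  The square root r of q keeps the exponents integral; the
    shifts s = 0 and s = -2 give the numerators and the denominators of K. *)
Definition theta (s z : int) : F :=
  let j := ((z - s) %/ 5)%Z in
  if (5 %| z - s)%Z then (-1) ^ j * r ^ (j * (5 * j + 2 * s + 1)) else 0.

Lemma theta_on s z j : z = 5 * j + s ->
  theta s z = (-1) ^ j * r ^ (j * (5 * j + 2 * s + 1)).
Proof. by move->; rewrite /theta addrK dvdz_mulr // mulKz. Qed.

Lemma theta_off s z : ~~ (5 %| z - s)%Z -> theta s z = 0.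
Proof. by rewrite /theta => /negPf ->. Qed.

Lemma theta_rec s z : r != 0 ->
  theta s z = - (r ^+ 2) ^ (z - 2) * theta s (z - 5).
Proof.
move=> r0; have [/dvdzP[j zj]|zs] := boolP (5 %| z - s)%Z; last first.
  rewrite !theta_off ?mulr0 //; apply: contra zs => /dvdzP[j E].
  by apply/dvdzP; exists (j + 1); lia.
rewrite (@theta_on s z j); last lia.
rewrite (@theta_on s (z - 5) (j - 1)); last lia.
have -> : (r ^+ 2) ^ (z - 2) = r ^ (2 * (z - 2)) by rewrite exprnP exprz_exp.
rewrite mulrCA !mulNr mulrN -expfzDr // -mulNr; congr (_ * r ^ _); last first.
  have -> : z = 5 * j + s by lia.
  by ring.
rewrite expfzDr ?oppr_eq0 ?oner_eq0 // -[RHS]mulrN -[LHS]mulr1; congr (_ * _).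
by rewrite -[LHS]opprK; congr (- _); rewrite -[LHS]invrN1.
Qed.

(** For m = 5 mu only the indices near m and - m contribute to the sums of length
    m and m + 1.  The congruence classes 0 and -2 modulo 5 meet them in at most
    one point each, which yields the two terms of each multiplier, respectively
    the vanishing of the denominator.  As r^(2m) = 1, the factor e is a sign. *)
Lemma K_prim_root mu : r != 0 -> (5 * mu).-primitive_root (r ^+ 2) ->
  let e := (-1) ^+ mu * r ^+ (5 * mu * mu) in
  [/\ Knum (r ^+ 2) (5 * mu) = e * (r ^+ mu + r ^- mu),
      Knum (r ^+ 2) (5 * mu).+1 = e * (r ^+ mu + r ^- mu),
      Kden (r ^+ 2) (5 * mu) = 0 &
      Kden (r ^+ 2) (5 * mu).+1 = e * (r ^+ (3 * mu) + r ^- (3 * mu))].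
Proof.
move=> r0 qm e; set q := r ^+ 2 in qm *.
have q0 : q != 0 by rewrite expf_neq0.
have mu0 : (0 < mu)%N by have := prim_order_gt0 qm; lia.
have vm s z : z = 5 * mu%:Z + s -> theta s z = e * r ^ ((2 * s + 1) * mu%:Z).
  move=> /theta_on ->.
  rewrite -mulrA -exprnP; congr (_ * _); rewrite !exprnP -expfzDr //.
  by congr (r ^ _); rewrite !PoszM; ring.
have vNm s z : z = - (5 * mu%:Z) + s -> theta s z = e * r ^ (- (2 * s + 1) * mu%:Z).
  move=> Ez; rewrite (@theta_on s z (- mu%:Z)); last lia.
  rewrite -mulrA; congr (_ * _).
    by rewrite -exprnN -exprVn invrN1.
  by rewrite !exprnP -expfzDr //; congr (r ^ _); rewrite !PoszM; ring.
have num n : Knum q n = schur q (theta 0) n.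
  apply: two_step_rec_uniq (KnumS q) (schur_rec q0 (fun z => theta_rec 0 z r0)) n.
    by rewrite schur0 (@theta_on 0 0 0) // theta_off // addr0 !expr0z mulr1.
  rewrite schur1 (@theta_off 0 1) // (@theta_on 0 0 0) // (@theta_off 0 (-1)) //.
  by rewrite (@theta_off 0 (-2)) // add0r !addr0 !expr0z mulr1.
have den n : Kden q n = schur q (theta (- 2)) n.
  apply: two_step_rec_uniq (KdenS q) (schur_rec q0 (fun z => theta_rec (-2) z r0)) n.
    by rewrite schur0 (@theta_off (-2) 0) // theta_off // addr0.
  rewrite schur1 (@theta_off (-2) 1) // (@theta_off (-2) 0) // (@theta_off (-2) (-1)) //.
  by rewrite (@theta_on (-2) (-2) 0) // !add0r !expr0z mulr1.
rewrite !num !den !(schur_prim_root _ qm) !(schur_prim_rootS _ qm) PoszM.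
split.
- rewrite (@vm 0) ?addr0 // (@theta_off 0 (_ - 1)); last lia.
  rewrite (@vNm 0) ?addr0 // (@theta_off 0 (_ - 1)); last lia.
  by rewrite !addr0 !mulr0 add0r mulN1r mul1r -exprnN mulrDr.
- rewrite (@theta_off 0 (_ + 1)); last lia.
  rewrite (@vm 0) ?addr0 // (@theta_off 0 (_ - 1)); last lia.
  rewrite (@theta_off 0 (_ - 2)); last lia.
  rewrite (@theta_off 0 (- _ + 1)); last lia.
  rewrite (@vNm 0) ?addr0 // (@theta_off 0 (_ - 1)); last lia.
  rewrite (@theta_off 0 (_ - 2)); last lia.
  by rewrite !addr0 !mulr0 !add0r mulN1r mul1r -exprnN mulrDr.
- by rewrite !theta_off ?addr0 //; lia.
rewrite (@theta_off _ (_ + 1)); last lia.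
rewrite (@theta_off _ (5 * _)); last lia.
rewrite (@theta_off _ (_ - 1)); last lia.
rewrite (@vm (-2)) //.
rewrite (@theta_off _ (- _ + 1)); last lia.
rewrite (@theta_off _ (- _)); last lia.
rewrite (@theta_off _ (- _ - 1)); last lia.
rewrite (@vNm (-2)) //.
rewrite !addr0 !add0r mulrDr addrC; congr (e * _ + e * _).
by rewrite exprnN; congr (r ^ _); lia.
Qed.
End Theta.

(** * The recurrence of K on the unit circle *)

Section Norm.
Context (R : realType).
Implicit Types x y z : R[i].

Lemma normc_ge0 x : 0 <= normc x.
Proof. by case: x => a b; exact: sqrtr_ge0. Qed.

Lemma normcN x : normc (- x) = normc x.
Proof. exact: (complex.normcN x). Qed.

Lemma normcD x y : normc (x + y) <= normc x + normc y.
Proof. exact: le_normcD. Qed.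

Lemma normcB x y : normc (x - y) <= normc x + normc y.
Proof. by rewrite -(normcN y); exact: normcD. Qed.

Lemma normcX x n : normc (x ^+ n) = normc x ^+ n.
Proof. by elim: n => [|n IHn]; rewrite ?normc1 // !exprS normcM IHn. Qed.

Lemma normc_real (a : R) : normc (a%:C)%C = `|a|.
Proof. by rewrite /normc /= expr0n addr0 sqrtr_sqr. Qed.

End Norm.

Section Recurrence.
Context (R : realType).
Implicit Types (x y : R[i]) (f g : nat -> R[i]).

Definition Krec x f := forall n, f n.+2 = f n.+1 + x ^+ n.+1 * f n.

(** As x^m = 1, the recurrence has period m, so scaling the initial vector by a
    over one period scales it by a^k over k periods. *)
Lemma Krec_periodic x f m a : Krec x f -> x ^+ m = 1 ->
  f m = a * f 0%N -> f m.+1 = a * f 1%N ->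
  forall k, f (k * m)%N = a ^+ k * f 0%N /\ f (k * m).+1 = a ^+ k * f 1%N.
Proof.
move=> hf xm f0 f1; have shift j : f (m + j)%N = a * f j.
  suff: f (m + j)%N = a * f j /\ f (m + j).+1 = a * f j.+1 by case.
  elim: j => [|j [IH1 IH2]]; first by rewrite addn0.
  rewrite addnS; split=> //; rewrite hf IH1 IH2 hf mulrDr -addnS exprD xm mul1r.
  by ring.
elim=> [|k [IH1 IH2]]; first by rewrite !expr0 !mul1r.
by rewrite mulSn -addnS !shift IH1 IH2 exprS !mulrA.
Qed.

Lemma Krec_bound x f : normc x = 1 -> Krec x f ->
  normc (f 0%N) <= 1 -> normc (f 1%N) <= 1 -> forall n, normc (f n) <= 2 ^+ n.
Proof.
move=> nx hf f0 f1 n; suff: normc (f n) <= 2 ^+ n /\ normc (f n.+1) <= 2 ^+ n.+1 by case.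
elim: n => [|n [IH1 IH2]]; first by rewrite expr0 expr1; split=> //; lra.
split=> //; rewrite hf; apply: (le_trans (normcD _ _)).
rewrite normcM normcX nx expr1n mul1r; move: IH1 IH2; rewrite !exprS.
have : 0 <= 2 ^+ n :> R by rewrite exprn_ge0.
lra.
Qed.

Lemma normc_subX x y n : normc x = 1 -> normc y = 1 ->
  normc (x ^+ n - y ^+ n) <= n%:R * normc (x - y).
Proof.
move=> nx ny; elim: n => [|n IHn]; first by rewrite !expr0 subrr normc0 mul0r.
have -> : x ^+ n.+1 - y ^+ n.+1 = x * (x ^+ n - y ^+ n) + (x - y) * y ^+ n.
  by rewrite !exprS; ring.
apply: (le_trans (normcD _ _)); rewrite !normcM normcX nx ny expr1n mul1r mulr1.
by rewrite -natr1 mulrDl mul1r lerD.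
Qed.

(** The perturbation is driven by (x^(n+1) - y^(n+1)) f_n, of size at most
    (n + 1) 2^n |x - y| <= 4^n |x - y|, and 4^(n+1) + 4^n + 4^n <= 4^(n+2). *)
Lemma Krec_perturb x y f g : normc x = 1 -> normc y = 1 -> Krec x f -> Krec y g ->
  f 0%N = g 0%N -> f 1%N = g 1%N -> normc (f 0%N) <= 1 -> normc (f 1%N) <= 1 ->
  forall n, normc (f n - g n) <= 4 ^+ n * normc (x - y).
Proof.
move=> nx ny hf hg E0 E1 b0 b1 n; set e := normc (x - y).
have e0 : 0 <= e by exact: normc_ge0.
suff: normc (f n - g n) <= 4 ^+ n * e /\ normc (f n.+1 - g n.+1) <= 4 ^+ n.+1 * e by case.
elim: n => [|n [IH1 IH2]].
  rewrite E0 E1 !subrr !normc0 expr0 expr1; split; lra.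
split=> //; rewrite hf hg.
have -> : f n.+1 + x ^+ n.+1 * f n - (g n.+1 + y ^+ n.+1 * g n) =
  (f n.+1 - g n.+1) + (y ^+ n.+1 * (f n - g n) + (x ^+ n.+1 - y ^+ n.+1) * f n) by ring.
apply: (le_trans (normcD _ _)); apply: (le_trans (lerD (lexx _) (normcD _ _))).
rewrite !normcM normcX ny expr1n mul1r.
have A : normc (x ^+ n.+1 - y ^+ n.+1) * normc (f n) <= (n.+1%:R * e) * 2 ^+ n.
  by apply: ler_pM; rewrite ?normc_ge0 ?normc_subX // (Krec_bound nx hf).
have B : n.+1%:R * 2 ^+ n <= 4 ^+ n :> R.
  have -> : (4 : R) = 2 * 2 by ring.
  by rewrite exprMn ler_wpM2r ?exprn_ge0 // -natrX ler_nat ltn_expl.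
have C : n.+1%:R * e * 2 ^+ n <= 4 ^+ n * e by rewrite mulrAC ler_wpM2r.
have D : 0 <= 4 ^+ n * e by rewrite mulr_ge0 // exprn_ge0.
have E k : 4 ^+ k.+1 * e = 4 * (4 ^+ k * e) by rewrite exprS mulrA.
move: IH1 IH2; rewrite !E; lra.
Qed.

End Recurrence.

(** * An obstruction to general convergence *)

Section Chordal.
Context (R : realType).
Implicit Types (f v w : Chat R).

(** Homogeneous coordinates on the sphere, with homN v the euclidean norm of
    hom v: they turn the chordal metric into |v ^ w| / (|v| |w|) and S_n into a
    linear map, and so make the point at infinity an ordinary one. *)
Definition hom v : R[i] * R[i] := if v is Some z then (z, 1) else (1, 0).
Definition homN v : R := if v is Some z then Num.sqrt (1 + normc z ^+ 2) else 1.

Lemma homN_gt0 v : 0 < homN v.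
Proof. by case: v => //= z; rewrite sqrtr_gt0 ltr_pwDl // sqr_ge0. Qed.

Lemma hom_le v : normc (hom v).1 <= homN v /\ normc (hom v).2 <= homN v.
Proof.
have sqrt_le (a b : R) : 0 <= a -> a ^+ 2 <= b -> a <= Num.sqrt b.
  move=> a0 ab; rewrite -[a]ger0_norm // -sqrtr_sqr ler_wsqrtr //.
case: v => [z|] /=; rewrite ?normc0 ?normc1 //; split.
  by apply: sqrt_le; rewrite ?normc_ge0 // lerDr.
by apply: sqrt_le => //; have := sqr_ge0 (normc z); rewrite expr1n; lra.
Qed.

Lemma chordalE v w :
  chordal v w = normc ((hom w).1 * (hom v).2 - (hom v).1 * (hom w).2) / (homN v * homN w).
Proof.
case: v w => [v|] [w|] /=.
- by rewrite !mulr1.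
- by rewrite mulr1 mulr0 subr0 normc1 mulr1 div1r.
- by rewrite mulr0 mulr1 sub0r normcN normc1 mul1r div1r.
- by rewrite !mulr0 !mulr1 subrr normc0 mul0r.
Qed.

Lemma chordal_ge0 v w : 0 <= chordal v w.
Proof. by rewrite chordalE divr_ge0 ?normc_ge0 // mulr_ge0 // ltW // homN_gt0. Qed.

Lemma wedge_chordal v w :
  normc ((hom w).1 * (hom v).2 - (hom v).1 * (hom w).2) = chordal v w * (homN v * homN w).
Proof. by rewrite chordalE divfK // mulf_neq0 // gt_eqF // homN_gt0. Qed.

(** Up to the choice of the norm of (p, q) this is the formula for the chordal
    distance, multiplied out so as to cover the degenerate case p = q = 0. *)
Lemma Chat_div_wedge p q f :
  normc ((hom f).1 * q - p * (hom f).2)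
    <= chordal (Chat_div p q) f * ((normc p + normc q) * homN f).
Proof.
rewrite /Chat_div; case: eqVneq => [->|q0].
  have := wedge_chordal None f; rewrite /= mulr0 !mul1r sub0r normcN => E.
  by rewrite sub0r normcN normcM E normc0 addr0 mulrCA.
have -> : (hom f).1 * q - p * (hom f).2 =
   q * ((hom f).1 * (hom (Some (p / q))).2 - (hom (Some (p / q))).1 * (hom f).2).
  by rewrite /=; field.
rewrite normcM wedge_chordal mulrCA ler_wpM2l ?chordal_ge0 // mulrA.
rewrite ler_wpM2r ?(ltW (homN_gt0 _)) //.
have nq : 0 < normc q by rewrite lt_def normc_ge0 andbT; apply: contra_neq q0 => /eq0_normc.
rewrite -[leRHS]ger0_norm ?addr_ge0 ?normc_ge0 // -[normc q in leLHS]ger0_norm ?normc_ge0 //.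
rewrite -!sqrtr_sqr /= -sqrtrM ?sqr_ge0 //.
rewrite ler_wsqrtr // normcM normcV mulrDr mulr1 exprMn mulrCA exprVn.
rewrite mulfV ?mulr1 ?expf_neq0 ?gt_eqF //.
have := normc_ge0 p; nra.
Qed.

(** cf_form f n and cf_form f (n + 1) are the coefficients of the linear form
    v |-> f ^ (S_n v), whose kernel is the preimage of f under S_n. *)
Definition cf_form (al b : nat -> R[i]) f n : R[i] :=
  (hom f).1 * cf_den al b n - cf_num al b n * (hom f).2.

Lemma cf_S_wedge (al b : nat -> R[i]) n v f :
  normc (cf_form al b f n * (hom v).1 + cf_form al b f n.+1 * (hom v).2)
   <= chordal (cf_S al b n v) f *
   ((normc (cf_num al b n) + normc (cf_num al b n.+1) +
     (normc (cf_den al b n) + normc (cf_den al b n.+1))) * homN v * homN f).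
Proof.
set p0 := cf_num al b n; set p1 := cf_num al b n.+1.
set q0 := cf_den al b n; set q1 := cf_den al b n.+1.
rewrite /cf_form -/p0 -/p1 -/q0 -/q1; set P := p1 * (hom v).2 + p0 * (hom v).1.
set Q := q1 * (hom v).2 + q0 * (hom v).1.
have -> : cf_S al b n v = Chat_div P Q.
  rewrite /P /Q; case: v {P Q} => [z|] /=; last by rewrite !mulr0 !mulr1 !add0r.
  by rewrite !mulr1 -!(mulrC z).
rewrite [X in normc X](_ : _ = (hom f).1 * Q - P * (hom f).2); last first.
  by rewrite /P /Q; ring.
apply: (le_trans (Chat_div_wedge _ _ _)); rewrite ler_wpM2l ?chordal_ge0 //.
rewrite ler_wpM2r ?(ltW (homN_gt0 _)) //.
have [h1 h2] := hom_le v.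
have bnd a c : normc (a * (hom v).2 + c * (hom v).1) <= (normc c + normc a) * homN v.
  apply: (le_trans (normcD _ _)); rewrite !normcM mulrDl addrC lerD //.
    by rewrite ler_wpM2l // normc_ge0.
  by rewrite ler_wpM2l // normc_ge0.
by rewrite mulrDl; apply: lerD; exact: bnd.
Qed.

Lemma limn_einf_gt0 (u : nat -> R) : (0 < limn_einf (fun n => (u n)%:E))%E ->
  exists2 d : R, 0 < d & exists N, forall n, (N <= n)%N -> d <= u n.
Proof.
rewrite limn_einf_lim.
rewrite (cvg_lim (@ereal_hausdorff R) (@cvg_einfs_sup R _)).
move=> /ereal_sup_gt[_ [N _ <-]] hN.
have leN n : (N <= n)%N -> (einfs (fun n => (u n)%:E) N <= (u n)%:E)%E.
  by move=> Nn; apply: ereal_inf_lbound; exists n.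
move: hN leN; case: (einfs _ N) => [d| |] //=.
  by rewrite lte_fin => d0 h; exists d => //; exists N => n /h; rewrite lee_fin.
by move=> _ /(_ N (leqnn N)).
Qed.

(** If the form l = (l0, l1) of cf_form is not small compared with the matrix of
    S_n, then S_n v can only be close to f when l v is small compared with |v|,
    that is, when v is close to the kernel of l.  If this holds for v and for w,
    they are close to each other: the identity
      l1 (v ^ w) = (l v) w_1 - (l w) v_1
    makes this quantitative. *)
Lemma not_general_limit (al b : nat -> R[i]) f c : 0 < c ->
  (forall N, exists2 n, (N <= n)%N &
    0 < normc (cf_form al b f n.+1) /\
    normc (cf_num al b n) + normc (cf_num al b n.+1) +
     (normc (cf_den al b n) + normc (cf_den al b n.+1))
      <= c * normc (cf_form al b f n.+1)) ->
  ~ converges_generally_to al b f.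
Proof.
move=> c0 hn [v [w [/limn_einf_gt0[d d0 [N0 hd]] cv cw]]].
have F0 := homN_gt0 f.
have [e Ee] : exists e, e = d / (4 * c * homN f) by eexists.
have e0 : 0 < e by rewrite Ee divr_gt0 // !mulr_gt0.
have small (u : nat -> Chat R) : Chat_cvg u f ->
    exists N, forall n, (N <= n)%N -> chordal (u n) f < e.
  move=> /cvgr0Pnorm_lt /(_ _ e0)[N _ hN]; exists N => n /hN /=.
  by rewrite ger0_norm ?chordal_ge0.
have [N1 h1] := small _ cv; have [N2 h2] := small _ cw.
have [n nN [l0 Ln]] := hn (N0 + N1 + N2)%N.
have {}hd := hd n ltac:(lia); have {}h1 := h1 n ltac:(lia); have {}h2 := h2 n ltac:(lia).
move: Ln l0 (cf_S_wedge al b n (v n) f) (cf_S_wedge al b n (w n) f) => /=.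
set L := _ + _ + (_ + _); set l0 := cf_form al b f n.
set l1 := cf_form al b f n.+1 => Ll l1_gt0 hv hw.
have [v1 v2] := hom_le (v n); have [w1 w2] := hom_le (w n).
have V0 := homN_gt0 (v n); have W0 := homN_gt0 (w n).
have L0 : 0 <= L by rewrite /L !addr_ge0 // normc_ge0.
have key : normc l1 * (chordal (v n) (w n) * (homN (v n) * homN (w n))) <=
   2 * (e * L * homN f * (homN (v n) * homN (w n))).
  rewrite -wedge_chordal -normcM.
  have -> : l1 * ((hom (w n)).1 * (hom (v n)).2 - (hom (v n)).1 * (hom (w n)).2) =
    (l0 * (hom (v n)).1 + l1 * (hom (v n)).2) * (hom (w n)).1 -
    (l0 * (hom (w n)).1 + l1 * (hom (w n)).2) * (hom (v n)).1 by ring.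
  apply: (le_trans (normcB _ _)); rewrite !normcM.
  have bnd A B C D (E : R) : 0 <= A -> 0 <= B ->
     A <= E * (L * C * homN f) -> E < e -> B <= D -> 0 < C ->
     A * B <= e * L * homN f * (C * D).
    move=> A0 B0 AH Hlt BD C0.
    have LCF : 0 <= L * C * homN f by rewrite !mulr_ge0 // ltW.
    have : A * B <= (e * (L * C * homN f)) * D.
      apply: ler_pM => //; apply: (le_trans AH); rewrite ler_wpM2r // ltW //.
    by congr (_ <= _); ring.
  rewrite mulr_natl mulr2n; apply: lerD.
    by apply: bnd hv h1 w1 V0; rewrite normc_ge0.
  by rewrite [homN (v n) * _]mulrC; apply: bnd hw h2 v1 W0; rewrite normc_ge0.
have VW : 0 < homN (v n) * homN (w n) by rewrite mulr_gt0.
move: key; rewrite !mulrA -mulrA -[X in _ <= X]mulrA (ler_pM2r VW) => key.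
have : normc l1 * d <= 2 * (e * (c * normc l1) * homN f).
  apply: (le_trans (ler_wpM2l (ltW l1_gt0) hd)); apply: (le_trans key).
  by rewrite -!mulrA ler_wpM2l // ler_wpM2l ?(ltW e0) // mulrA ler_wpM2r ?(ltW F0).
have -> : 2 * (e * (c * normc l1) * homN f) = normc l1 * d / 2.
  by rewrite Ee; field; rewrite !gt_eqF.
have : 0 < normc l1 * d by rewrite mulr_gt0.
lra.
Qed.

End Chordal.

(** * Regular continued fractions with natural partial quotients *)

Section RegularCF.
Local Open Scope nat_scope.
Context (a : nat -> nat).

(** The indices are shifted as in cf_rec: conv_num n.+1 / conv_den n.+1 is the
    n-th convergent c_n / d_n. *)
Fixpoint conv_rec (u0 u1 n : nat) : nat :=
  match n with
  | 0 => u0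
  | m.+1 => match m with
            | 0 => u1
            | k.+1 => a m * conv_rec u0 u1 m + conv_rec u0 u1 k
            end
  end.

Definition conv_num := conv_rec 1 (a 0).
Definition conv_den := conv_rec 0 1.

Lemma conv_recS u0 u1 n :
  conv_rec u0 u1 n.+2 = a n.+1 * conv_rec u0 u1 n.+1 + conv_rec u0 u1 n.
Proof. by []. Qed.

Lemma cf_rec_nat (F : fieldType) u0 u1 n :
  (cf_rec (fun=> 1) (fun i => (a i)%:R) u0%:R u1%:R n = (conv_rec u0 u1 n)%:R :> F)%R.
Proof.
suff: (cf_rec (fun=> 1) (fun i => (a i)%:R) u0%:R u1%:R n = (conv_rec u0 u1 n)%:R :> F)%R
  /\ (cf_rec (fun=> 1) (fun i => (a i)%:R) u0%:R u1%:R n.+1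
      = (conv_rec u0 u1 n.+1)%:R :> F)%R by case.
elim: n => [|n [IH0 IH1]] //; split=> //.
by rewrite conv_recS natrD natrM -IH0 -IH1 [LHS]/= mul1r.
Qed.

Lemma conv_det n : (((conv_num n.+1)%:Z * (conv_den n)%:Z
  - (conv_num n)%:Z * (conv_den n.+1)%:Z = (- 1) ^+ n.+1)%R).
Proof.
elim: n => [|n IHn]; first by rewrite /conv_num /conv_den /= mulr0 mulr1.
by rewrite exprS -IHn /conv_num /conv_den !conv_recS !PoszD !PoszM; ring.
Qed.

Lemma conv_coprime n : coprime (conv_num n) (conv_den n).
Proof.
case: n => [|n]; first by rewrite /coprime gcd1n.
have := conv_det n; set g := gcdn (conv_num n.+1) (conv_den n.+1) => E.
have gn : (g%:Z %| (conv_num n.+1)%:Z)%Z by rewrite dvdzE dvdn_gcdl.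
have gd : (g%:Z %| (conv_den n.+1)%:Z)%Z by rewrite dvdzE dvdn_gcdr.
have : (g%:Z %| ((-1) ^+ n.+1)%R)%Z.
  case/dvdzP: gn => x Ex; case/dvdzP: gd => y Ey; rewrite -E Ex Ey; apply/dvdzP.
  by exists (x * (conv_den n)%:Z - (conv_num n)%:Z * y)%R; ring.
by rewrite dvdzE abszX /= exp1n dvdn1.
Qed.

Lemma conv_rec_mod5 u0 u1 n : (forall i, n < i -> a i = 1 %[mod 5]) ->
  conv_rec u0 u1 n.+2 = conv_rec u0 u1 n.+1 + conv_rec u0 u1 n %[mod 5].
Proof.
move=> ha; rewrite conv_recS -modnDml -modnMml ha ?ltnS //.
by rewrite modnMml mul1n modnDml.
Qed.

(** Modulo 5 the recurrence is that of Fibonacci, whose solutions are multiplied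
    by 3 every five steps, since F_5 = 0 and F_6 = 3 modulo 5; and multiplication
    by 3 exchanges the classes 1, 4 and 2, 3. *)
Lemma conv_mod5_cycle k : a 0 = 0 -> a 1 = 2 ->
  (forall i, 1 < i -> a i = 1 %[mod 5]) ->
  conv_den (5 * k + 4) = 0 %[mod 5] /\
  conv_num (5 * k + 4) %% 5 \in (if odd k then [:: 1; 4] else [:: 2; 3]).
Proof.
move=> a0 a1 ha.
have fib u0 u1 n : 0 < n ->
    conv_rec u0 u1 n.+2 = conv_rec u0 u1 n.+1 + conv_rec u0 u1 n %[mod 5].
  by move=> n0; apply: conv_rec_mod5 => i ni; apply: ha; lia.
have step u0 u1 n : 0 < n -> conv_rec u0 u1 (n + 5) = 3 * conv_rec u0 u1 n %[mod 5].
  move=> n0; rewrite !addnS addn0.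
  have := fib u0 u1 n n0; have := fib u0 u1 n.+1 isT.
  have := fib u0 u1 n.+2 isT; have := fib u0 u1 n.+3 isT.
  by lia.
elim: k => [|k [IHD IHC]].
  rewrite /conv_den /conv_num muln0 add0n.
  have E u0 u1 : conv_rec u0 u1 4 = 2 * (2 * u1 + u0) + u1 %[mod 5].
    have := fib u0 u1 2 isT; have := fib u0 u1 1 isT.
    rewrite [conv_rec _ _ 2]conv_recS a1 [conv_rec _ _ 1]/= [conv_rec _ _ 0]/=; lia.
  by rewrite !E a0.
have -> : 5 * k.+1 + 4 = 5 * k + 4 + 5 by lia.
rewrite /conv_den /conv_num !step ?addnS //; split.
  by rewrite -!addnS -modnMmr IHD.
move: IHC; rewrite /conv_num -!addnS /=; case: (odd k); rewrite !inE /=; lia.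
Qed.

Context (a_gt0 : forall i, 0 < i -> 0 < a i).

Lemma conv_den_gt0 n : 0 < conv_den n.+1.
Proof.
suff: 0 < conv_den n.+1 /\ 0 < conv_den n.+2 by case.
elim: n => [|n [IH0 IH1]]; first by rewrite /conv_den /= muln1 addn0; split=> //; exact: a_gt0.
by split=> //; rewrite /conv_den conv_recS addn_gt0 IH0 orbT.
Qed.

Lemma conv_den_ltS n : conv_den n.+2 < conv_den n.+3.
Proof.
rewrite /conv_den [conv_rec _ _ n.+3]conv_recS -/(conv_den n.+1) -/(conv_den n.+2).
have := conv_den_gt0 n; have := a_gt0 (ltn0Sn n.+1); nia.
Qed.

End RegularCF.

(** * Growth of the towers *)

Section Towers.
Local Open Scope nat_scope.

Lemma tower_ge j z : z <= tower j z.
Proof. by elim: j => //= j IHj; apply: leq_trans IHj _; exact/ltnW/ltn_expl. Qed.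

Lemma towerS j z : tower j.+1 z = 2 ^ tower j z. Proof. by []. Qed.

Lemma tower_sqr j z : (tower j.+2 z) ^ 2 <= tower j.+2 z.+1.
Proof.
elim: j => [|j IHj]; first by rewrite /= -expnM expnS mulnC.
rewrite towerS [X in _ <= X]towerS -expnM leq_exp2l //.
apply: leq_trans IHj; rewrite expnS expn1 leq_mul2l; apply/orP; right.
by rewrite towerS -{1}(expn1 2) leq_exp2l // towerS expn_gt0.
Qed.

Lemma tower_pow4 j z : 0 < z -> (tower j.+3 z) ^ 4 <= tower j.+3 z.+1.
Proof.
move=> z0; rewrite towerS [X in _ <= X]towerS -expnM leq_exp2l //.
apply: leq_trans (tower_sqr j z); rewrite expnS expn1 leq_mul2l; apply/orP; right.
rewrite towerS -[4]/(2 ^ 2) leq_exp2l // towerS.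
by rewrite -{1}(expn1 2) leq_exp2l // (leq_trans z0) // tower_ge.
Qed.

Lemma tower_quotient_gt0 i : 0 < i -> 0 < tower_quotient i.
Proof. by case: i => // i _; rewrite /tower_quotient towerS expn_gt0. Qed.

(** From i = 2 on the exponent of 2 is itself a power of 2 divisible by 4, and
    16 = 1 modulo 5. *)
Lemma tower_quotient_mod5 i : 1 < i -> tower_quotient i = 1 %[mod 5].
Proof.
case: i => [|[|i]] // _; rewrite /tower_quotient !towerS.
have := tower_ge i i.+2; case: (tower i i.+2) => [|[|k]] // _.
by rewrite !expnS mulnA expnM -modnXm exp1n.
Qed.

Local Notation D := (conv_den tower_quotient).

Lemma conv_den_lt_quotient n : 0 < n -> D n.+1 < tower_quotient n.+1.
Proof.
case: n => // n _; elim: n => [|n IHn]; first by [].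
have : D n.+3 <= tower_quotient n.+2 ^ 2.
  rewrite /conv_den conv_recS -/(D _) -/(D _).
  have := conv_den_gt0 tower_quotient_gt0 n.
  have : D n.+1 <= D n.+2.
    case: n {IHn} => [|n]; first by [].
    exact/ltnW/(conv_den_ltS tower_quotient_gt0).
  have := tower_quotient_gt0 (ltn0Sn n.+1); move: IHn.
  by rewrite expnS expn1; nia.
move=> /leq_ltn_trans; apply.
rewrite [X in _ < X]/tower_quotient towerS.
by apply: leq_ltn_trans (ltn_expl _ _); [exact: tower_sqr|].
Qed.

(** The exponent of 2 in a_(n+1) is at least 2 N + 7, with N = n d_n, the number of
    binary digits needed to keep the perturbation at index N + 1 at most 1:
    d_n <= a_n^2, while the exponent is at least a_n^4. *)
Lemma conv_den_tower n : 2 < n -> 2 * (n * D n.+1) + 7 <= tower n n.+1.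
Proof.
case: n => [|[|[|n]]] // _; have := tower_pow4 n (ltn0Sn n.+2).
set T := tower _ n.+3 => hT.
have nT : n.+3 <= T by exact: tower_ge.
suff : D n.+4 <= T ^ 2.
  move=> hD; have T3 : 2 < T by lia.
  have : n.+3 * D n.+4 <= T * T ^ 2 by exact: leq_mul.
  have : 2 * (T * T ^ 2) + 7 <= T ^ 4.
    have : 3 ^ 3 <= T * T ^ 2 by rewrite -expnS leq_exp2r.
    by rewrite (expnS T 3) -(expnS T 2); nia.
  by lia.
rewrite /conv_den conv_recS -/(D _) -/(D _).
have := conv_den_lt_quotient (ltn0Sn n.+1); have := conv_den_ltS tower_quotient_gt0 n.
rewrite -[tower_quotient n.+3]/T.
by rewrite expnS expn1; nia.
Qed.

End Towers.

(** * Approximation by the convergents *)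

Section Approx.
Context (R : realType) (a : nat -> nat) (t : R).
Local Notation C := (conv_num a).
Local Notation D := (conv_den a).

(** Consecutive convergents differ by 1 / (d_k d_(k+1)) <= 1 / d_k - 1 / d_(k+1),
    which telescopes. *)
Lemma regular_cf_approx n : has_regular_cf a t ->
  `|t - (C n.+1)%:R / (D n.+1)%:R| <= 2 / (D n.+2)%:R.
Proof.
move=> [a0 ht]; set s := _ / _.
have Dpos k : 0 < (D k.+1)%:R :> R by rewrite ltr0n (conv_den_gt0 a0).
have step k : `|(C k.+2)%:R / (D k.+2)%:R - (C k.+1)%:R / (D k.+1)%:R|
    = ((D k.+1)%:R * (D k.+2)%:R)^-1 :> R.
  have -> : (C k.+2)%:R / (D k.+2)%:R - (C k.+1)%:R / (D k.+1)%:R =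
     ((C k.+2)%:R * (D k.+1)%:R - (C k.+1)%:R * (D k.+2)%:R) / ((D k.+1)%:R * (D k.+2)%:R) :> R.
    by field; rewrite !gt_eqF.
  have := congr1 (fun z : int => z%:~R : R) (conv_det a k.+1).
  rewrite rmorphXn rmorphN1 rmorphB !rmorphM /= -!pmulrn => ->.
  rewrite normrM normrX normrN1 expr1n mul1r ger0_norm //.
have bound k : `|(C (n + k).+2)%:R / (D (n + k).+2)%:R - s|
    <= 2 / (D n.+2)%:R - ((D (n + k).+2)%:R)^-1.
  elim: k => [|k IHk].
    rewrite addn0 step invfM.
    have : (D n.+1)%:R^-1 <= 1 :> R by rewrite invf_le1 ?Dpos // ler1n (conv_den_gt0 a0).
    have : 0 < (D n.+2)%:R^-1 :> R by rewrite invr_gt0.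
    nra.
  rewrite addnS; apply: (le_trans (ler_distD ((C (n + k).+2)%:R / (D (n + k).+2)%:R) _ _)).
  apply: (le_trans (lerD (lexx _) IHk)); rewrite step addrCA lerD2l.
  set x : R := (D (n + k).+2)%:R; set y : R := (D (n + k).+3)%:R.
  have x0 : 0 < x by exact: Dpos.
  have xy : x + 1 <= y by rewrite natr1 ler_nat (conv_den_ltS a0).
  rewrite lerBlDr addrC.
  have -> : x^-1 - y^-1 = (y - x) * (x * y)^-1 by field; rewrite !gt_eqF //; lra.
  rewrite ler_peMl ?invr_ge0; nra.
have lim : (fun k => `|(C (k + n.+1).+1)%:R / (D (k + n.+1).+1)%:R - s|) @ \oo --> `|t - s|.
  apply: cvg_norm; apply: cvgB; last exact: cvg_cst.
  move: ht; rewrite -(cvg_shiftn n.+1) /=; apply: cvg_trans; apply: near_eq_cvg.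
  apply: nearW => k.
  by rewrite /cf_num /cf_den -(cf_rec_nat a R 1 (a 0)) -(cf_rec_nat a R 0 1).
apply: (cvgr_to_le lim); apply: nearW => k.
rewrite addnC addSn; apply: (le_trans (bound k)).
by rewrite lerBlDr lerDl invr_ge0 ltW.
Qed.

End Approx.

(** * The unit circle and the golden ratio *)

Section Circle.
Context (R : realType).
Implicit Types a b : R.

Definition cis a : R[i] := (cos a +i* sin a)%C.

Lemma expc_imag a : expc (a *i)%C = cis a.
Proof. by rewrite /expc /= expR0 mul1r. Qed.

Lemma cisD a b : cis (a + b) = cis a * cis b.
Proof. by apply/eqP; rewrite eq_complex /= cosD sinD (addrC (sin a * _)) !eqxx. Qed.

Lemma cis0 : cis 0 = 1.
Proof. by rewrite /cis cos0 sin0. Qed.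

Lemma cisX a n : cis a ^+ n = cis (n%:R * a).
Proof.
elim: n => [|n IHn]; first by rewrite mul0r cis0.
by rewrite exprS IHn -cisD -natr1 mulrDl mul1r addrC.
Qed.

Lemma normc_cis a : normc (cis a) = 1.
Proof. by rewrite /normc /= cos2Dsin2 sqrtr1. Qed.

Lemma cis_neq0 a : cis a != 0.
Proof.
by apply/eqP => /(congr1 (@normc R)); rewrite normc_cis normc0 => /eqP; rewrite oner_eq0.
Qed.

Lemma cisV a : (cis a)^-1 = cis (- a).
Proof. by apply: (mulfI (cis_neq0 a)); rewrite divff ?cis_neq0 // -cisD subrr cis0. Qed.

Lemma cisDV a : cis a + (cis a)^-1 = (2 * cos a)%:C%C.
Proof.
rewrite cisV; apply/eqP; rewrite eq_complex /= cosN sinN subrr eqxx andbT.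
by apply/eqP; ring.
Qed.

Lemma cis_2pin n : cis (n%:R * (2 * pi)) = 1.
Proof.
have -> : n%:R * (2 * pi) = 0 + (pi *+ 2) *+ n :> R.
  by rewrite add0r -mulrnA -[RHS]mulr_natl natrM; ring.
by rewrite /cis (periodicn (@cosD2pi R)) (periodicn (@sinD2pi R)) cos0 sin0.
Qed.

Lemma lipschitz_is_derive (f df : R -> R) : continuous f ->
  (forall x : R, is_derive x 1 f (df x)) -> (forall x, `|df x| <= 1) ->
  forall a b, `|f a - f b| <= `|a - b|.
Proof.
move=> cf hf df1; suff H a b : a <= b -> `|f b - f a| <= `|b - a|.
  move=> a b; case: (leP a b) => [ab|/ltW ba]; last exact: H.
  by rewrite distrC (distrC a); exact: H.
move=> ab; have [x _ ->] := @MVT_segment _ f df _ _ ab (fun x _ => hf x)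
  (continuous_subspaceT cf).
by rewrite normrM ler_piMl.
Qed.

Lemma normc_le (z : R[i]) : normc z <= `|complex.Re z| + `|complex.Im z|.
Proof.
case: z => x y; rewrite /normc /=.
rewrite -[leRHS]ger0_norm ?addr_ge0 // -sqrtr_sqr ler_wsqrtr //.
rewrite sqrrD !real_normK ?num_real // addrAC lerDl.
by rewrite mulrn_wge0 // mulr_ge0.
Qed.

Lemma cis_lipschitz a b : normc (cis a - cis b) <= 2 * `|a - b|.
Proof.
apply: (le_trans (normc_le _)); rewrite /= mulr_natl mulr2n lerD //.
  apply: (@lipschitz_is_derive _ (- sin)) => [|x]; first exact: continuous_cos.
  by rewrite normrN sin_max.
apply: (@lipschitz_is_derive _ cos) => [|x]; first exact: continuous_sin.
exact: cos_max.
Qed.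

(** By 1 - cos a = 2 sin^2 (a / 2). *)
Lemma cis_neq1 a : 0 < a < 2 * pi -> cis a != 1.
Proof.
move=> /andP[a0 a2]; rewrite eq_complex /= negb_and; apply/orP; left.
have -> : a = (a / 2) *+ 2 by rewrite -mulr_natr divfK.
rewrite cos_mulr2n cos2sin2.
have : 0 < sin (a / 2) by apply: sin_gt0_pi; lra.
set s := sin _ => s0; have : 0 < s ^+ 2 by rewrite exprn_gt0.
by move=> s2; apply: contraTneq s2; rewrite mulr2n => E; rewrite -leNgt; lra.
Qed.

Lemma cis_prim_root c d : (0 < d)%N -> coprime c d ->
  d.-primitive_root (cis (2 * pi * (c%:R / d%:R))).
Proof.
move=> d0 cd; set q := cis _.
have dR : (d%:R : R) != 0 by rewrite pnatr_eq0 -lt0n.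
have qm m : q ^+ m = cis (((m * c) %% d)%N%:R / d%:R * (2 * pi)).
  rewrite cisX -[RHS]mul1r -(cis_2pin (m * c %/ d)) -cisD.
  congr cis; have := congr1 (fun k => k%:R : R) (divn_eq (m * c) d).
  rewrite natrD !natrM => E.
  have -> : m%:R * (2 * pi * (c%:R / d%:R)) = m%:R * c%:R / d%:R * (2 * pi) :> R by ring.
  by rewrite E; field.
have [|m mq md] := @prim_order_exists _ d q d0.
  by rewrite qm mulnC modnMl !mul0r cis0.
suff <- : m = d by [].
apply/eqP; rewrite eqn_dvd md -(@Gauss_dvdl d m c) 1?coprime_sym //.
apply/eqP; have := prim_expr_order mq; rewrite qm; set r := (_ %% _)%N.
case: (posnP r) => // r0 /eqP; apply: contraTeq => _; apply: cis_neq1.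
have rd : (r < d)%N by rewrite ltn_mod.
have p0 : 0 < pi :> R := pi_gt0 R.
rewrite mulr_gt0 ?divr_gt0 ?ltr0n //=; last by rewrite mulr_gt0.
by rewrite gtr_pMl ?mulr_gt0 // ltr_pdivrMr ?ltr0n // mul1r ltr_nat.
Qed.

(** With A and B the two cosines, the duplication formula gives B = 2 A^2 - 1 and
    - A = cos (4 pi / 5) = 2 B^2 - 1; subtracting, A - B = 1 / 2.  So 2 A is the
    golden ratio and 2 B its inverse. *)
Lemma cos_pi5 : 1 / 2 < cos (pi / 5 : R) /\ 0 < cos (2 * (pi / 5) : R) < 1 / 2.
Proof.
have p0 : 0 < pi :> R := pi_gt0 R.
set A := cos _; set B := cos _.
have A0 : 0 < A by apply: cos_gt0_pihalf; apply/andP; split; lra.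
have B0 : 0 < B by apply: cos_gt0_pihalf; apply/andP; split; lra.
have E1 : B = 2 * A ^+ 2 - 1.
  by rewrite /B mulr_natl cos_mulr2n mulr_natl.
have E2 : - A = 2 * B ^+ 2 - 1.
  rewrite /A -cosDpi; have -> : pi / 5 + pi = 2 * pi - 2 * (2 * (pi / 5)) :> R by field.
  have -> : 2 * pi - 2 * (2 * (pi / 5)) = - ((2 * (pi / 5)) *+ 2) + pi *+ 2 :> R.
    by rewrite !mulr2n; ring.
  by rewrite cosD2pi cosN cos_mulr2n -/B !mulr2n; ring.
have AB : A - B = 1 / 2.
  have /mulfI : A + B != 0 by rewrite gt_eqF // addr_gt0.
  by apply; nra.
by split; [lra|apply/andP; split => //; nra].
Qed.

(** Reducing c modulo 5 changes the angle by a multiple of pi, hence the cosine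
    by a sign. *)
Lemma normc_cis5 c :
  normc (cis (c%:R * (pi / 5)) + (cis (c%:R * (pi / 5)))^-1)
   = 2 * `|cos ((c %% 5)%:R * (pi / 5))|.
Proof.
rewrite cisDV normc_real normrM ger0_norm //; congr (_ * _).
rewrite {1}(divn_eq c 5) natrD natrM mulrDl addrC.
have -> : (c %/ 5)%:R * 5 * (pi / 5) = pi *+ (c %/ 5) :> R by rewrite -[RHS]mulr_natl; field.
by rewrite (alternatingn (@cosDpi R)) normrM normrX normrN1 expr1n mul1r.
Qed.

Lemma normc_cis5_golden c : (c %% 5)%N \in [:: 1; 4]%N ->
  normc (cis (c%:R * (pi / 5)) + (cis (c%:R * (pi / 5)))^-1) = 2 * cos (pi / 5 : R).
Proof.
have [h _] := cos_pi5; rewrite normc_cis5 !inE => /orP[]/eqP ->.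
  by rewrite mul1r gtr0_norm //; lra.
have -> : 4 * (pi / 5) = - (pi / 5) + pi :> R by field.
by rewrite cosDpi normrN cosN gtr0_norm //; lra.
Qed.

Lemma normc_cis5_lt1 c : (c %% 5)%N \in [:: 2; 3]%N ->
  normc (cis (c%:R * (pi / 5)) + (cis (c%:R * (pi / 5)))^-1) < 1.
Proof.
have [_ /andP[h0 h1]] := cos_pi5; rewrite normc_cis5 !inE => /orP[]/eqP ->.
  by rewrite gtr0_norm //; lra.
have -> : 3 * (pi / 5) = - (2 * (pi / 5)) + pi :> R by field.
by rewrite cosDpi normrN cosN gtr0_norm //; lra.
Qed.

End Circle.

(** * Divergence of K at y *)

Section Main.
Context (R : realType).

Lemma Knum_rec (x : R[i]) : Krec x (Knum x). Proof. exact: KnumS. Qed.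
Lemma Kden_rec (x : R[i]) : Krec x (Kden x). Proof. exact: KdenS. Qed.

(** The absolute value of 2 cos (c pi / 5), in the shape in which K_prim_root
    produces it: the golden ratio or its inverse when 5 does not divide c. *)
Definition two_cos5 (c : nat) : R :=
  normc (cis (c%:R * (pi / 5)) + (cis (c%:R * (pi / 5)))^-1).

Lemma K_root_of_unity c mu n : (0 < mu)%N -> coprime c (5 * mu) ->
  let x := cis (2 * pi * (c%:R / (5 * mu)%N%:R)) : R[i] in
  let N := (n * (5 * mu))%N in
  [/\ normc (Knum x N) = two_cos5 c ^+ n,
      normc (Knum x N.+1) = two_cos5 c ^+ n,
      normc (Kden x N) = 0 &
      normc (Kden x N.+1) = two_cos5 (3 * c) ^+ n].
Proof.
move=> mu0 cop x N; have d0 : (0 < 5 * mu)%N by rewrite muln_gt0.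
have xprim := cis_prim_root R d0 cop.
pose r : R[i] := cis (pi * (c%:R / (5 * mu)%N%:R)).
have r2 : r ^+ 2 = x by rewrite cisX mulrA.
have muR : (mu%:R : R) != 0 by rewrite pnatr_eq0 -lt0n.
have rmu : r ^+ mu = cis (c%:R * (pi / 5)).
  by rewrite cisX natrM; congr cis; field; rewrite muR.
have r3mu : r ^+ (3 * mu) = cis ((3 * c)%N%:R * (pi / 5)).
  by rewrite cisX !natrM; congr cis; field; rewrite muR.
have := @K_prim_root _ r mu (cis_neq0 _); rewrite r2 => /(_ xprim) /= [].
set e := (-1) ^+ mu * _ => n0 n1 d0' d1.
have ne : normc e = 1.
  by rewrite /e normcM !normcX normcN normc1 normc_cis !expr1n mulr1.
clearbody e; have xm := prim_expr_order xprim.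
have [-> ->] := Krec_periodic (a := e * (r ^+ mu + r ^- mu)) (Knum_rec x) xm
  (etrans n0 (esym (mulr1 _))) (etrans n1 (esym (mulr1 _))) n.
have [-> ->] := Krec_periodic (a := e * (r ^+ (3 * mu) + r ^- (3 * mu))) (Kden_rec x) xm
  (etrans d0' (esym (mulr0 _))) (etrans d1 (esym (mulr1 _))) n.
rewrite !mulr0 normc0 !mulr1 !normcX !normcM ne !mul1r rmu r3mu.
by split.
Qed.

Local Notation C := (conv_num tower_quotient).
Local Notation D := (conv_den tower_quotient).

Lemma tower_conv_mod5 k :
  D (5 * k + 4) = 0 %[mod 5] /\
  (C (5 * k + 4) %% 5)%N \in (if odd k then [:: 1; 4] else [:: 2; 3])%N.
Proof.
by apply: conv_mod5_cycle => // i; exact: tower_quotient_mod5.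
Qed.

Context (t : R) (ht : has_regular_cf tower_quotient t).
Let y : R[i] := cis (2 * pi * t).

(** At n = 5 k + 3 the order of the root of unity is divisible by 5, and n of its
    periods, that is, N = n d_n, are both long enough for the n-th powers to be
    unbounded and short enough for the perturbation to be at most 1. *)
Lemma K_near k (n := (5 * k + 3)%N) : exists N : nat, [/\ (n <= N)%N,
   `|normc (Knum y N) - two_cos5 (C n.+1) ^+ n| <= 1,
   `|normc (Knum y N.+1) - two_cos5 (C n.+1) ^+ n| <= 1,
   normc (Kden y N) <= 1 &
   `|normc (Kden y N.+1) - two_cos5 (3 * C n.+1) ^+ n| <= 1].
Proof.
have [D5 _] := tower_conv_mod5 k.
have nE : (5 * k + 4 = n.+1)%N by rewrite /n -addnS.
rewrite nE in D5.
have D0 := conv_den_gt0 tower_quotient_gt0 n.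
have [mu Dmu] : exists mu, D n.+1 = (5 * mu)%N.
  by exists (D n.+1 %/ 5)%N; lia.
have mu0 : (0 < mu)%N by lia.
have cop := conv_coprime tower_quotient n.+1; rewrite Dmu in cop.
have := K_root_of_unity n mu0 cop.
set x := cis _; set N := (n * _)%N => /= [[xn0 xn1 xd0 xd1]].
exists N.
have close : 4 ^+ N.+1 * normc (y - x) <= 1.
  (* 32 >= 2 * 2 pi * 2: Lipschitz constant, angle, approximation of t. *)
  have yx : normc (y - x) <= 32 / (D n.+2)%:R.
    apply: (le_trans (cis_lipschitz _ _)).
    have := regular_cf_approx n ht; rewrite Dmu -mulrBr.
    rewrite normrM [ `|2 * pi|]ger0_norm ?mulr_ge0 ?pi_ge0 //.
    have := pihalf_lt2 R; have := pi_gt0 R.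
    set p : R := pi; set s := `|_|; set q : R := 2 / (D n.+2)%:R => p0 p4 sq.
    have s0 : 0 <= s by exact: normr_ge0.
    have -> : 32 / (D n.+2)%:R = 16 * q by rewrite /q; ring.
    have ps : p * s <= 4 * q by apply: ler_pM => //; lra.
    have -> : 2 * (2 * p * s) = 4 * (p * s) by ring.
    lra.
  have big : 2 ^+ (2 * N + 7) <= (D n.+2)%:R :> R.
    rewrite -natrX ler_nat; apply: (@leq_trans (tower_quotient n.+1)).
      rewrite /tower_quotient towerS leq_exp2l //.
      have n2 : (2 < n)%N by rewrite /n; lia.
      by have := conv_den_tower n2; rewrite Dmu.
    rewrite /conv_den conv_recS -/(D _).
    by apply: leq_trans (leq_addr _ _); rewrite leq_pmulr.
  have D2 : 0 < (D n.+2)%:R :> R by rewrite ltr0n conv_den_gt0 //; exact: tower_quotient_gt0.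
  apply: (le_trans (ler_wpM2l (exprn_ge0 _ _) yx)) => //.
  rewrite mulrA ler_pdivrMr // mul1r; apply: le_trans big.
  have -> : (2 * N + 7 = 2 * N.+1 + 5)%N by lia.
  have E4 : 2 ^+ 2 = 4 :> R by ring.
  have E32 : 2 ^+ 5 = 32 :> R by ring.
  by rewrite exprD exprM E4 E32.
have close0 : 4 ^+ N * normc (y - x) <= 1.
  apply: le_trans close; rewrite ler_wpM2r ?normc_ge0 // exprS ler_peMl //.
  by lra.
have nxy (u v : R[i]) (e : R) : normc (u - v) <= e -> e <= 1 -> `|normc u - normc v| <= 1.
  move=> uv e1; have := normcD (u - v) v; have := normcB u (u - v).
  have -> : u - (u - v) = v by ring.
  by rewrite subrK => h1 h2; rewrite ler_norml; apply/andP; split; lra.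
have b0 : normc (0 : R[i]) <= 1 by rewrite normc0.
have b1 : normc (1 : R[i]) <= 1 by rewrite normc1.
have pn := Krec_perturb (normc_cis _) (normc_cis _) (Knum_rec y) (Knum_rec x)
  erefl erefl b1 b1.
have pd := Krec_perturb (normc_cis _) (normc_cis _) (Kden_rec y) (Kden_rec x)
  erefl erefl b0 b1.
split.
- by rewrite leq_pmulr // -Dmu.
- by rewrite -xn0; exact: nxy (pn _) close0.
- by rewrite -xn1; exact: nxy (pn _) close.
- by have := nxy _ _ _ (pd N) close0; rewrite xd0 subr0 ger0_norm ?normc_ge0.
- by rewrite -xd1; exact: nxy (pd _) close.
Qed.

(** By Bernoulli's inequality. *)
Lemma pow_unbounded (g M : R) : 1 < g -> exists n0, forall n, (n0 <= n)%N -> M <= g ^+ n.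
Proof.
move=> g1; have bern n : 1 + n%:R * (g - 1) <= g ^+ n.
  elim: n => [|n IHn]; first by rewrite mul0r addr0 expr0.
  have n_ge0 : 0 <= n%:R * (g - 1) ^+ 2 by rewrite mulr_ge0 // sqr_ge0.
  have : g * (1 + n%:R * (g - 1)) <= g * g ^+ n by rewrite ler_wpM2l //; lra.
  rewrite exprS; apply: le_trans; rewrite -natr1; move: n_ge0; rewrite expr2; lra.
exists (Num.bound `|M / (g - 1)|) => n hn; apply: le_trans (bern n).
have g0 : 0 < g - 1 by rewrite subr_gt0.
have : M / (g - 1) <= n%:R.
  apply: (le_trans (ler_norm _)); apply: ltW.
  apply: (lt_le_trans (archi_boundP (normr_ge0 _))).
  by rewrite ler_nat.
rewrite ler_pdivrMr //; lra.
Qed.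

Lemma two_cos5_golden (M : R) N0 : exists n0, forall k, (n0 <= k)%N ->
  forall c, (c %% 5)%N \in [:: 1; 4]%N -> (N0 <= 5 * k + 3)%N /\ M <= two_cos5 c ^+ (5 * k + 3).
Proof.
have g1 : 1 < 2 * cos (pi / 5 : R) by have [h _] := cos_pi5 R; lra.
have [n0 h] := pow_unbounded M g1; exists (n0 + N0)%N => k hk c hc; split; first lia.
by rewrite /two_cos5 normc_cis5_golden //; apply: h; lia.
Qed.

Lemma K_diverges : ~ converges_generally (fun n => y ^+ n) (fun=> 1).
Proof.
have pow_le1 c n : (c %% 5)%N \in [:: 2; 3]%N -> 0 <= two_cos5 c ^+ n <= 1.
  move=> hc; rewrite exprn_ge0 ?normc_ge0 //= exprn_ile1 ?normc_ge0 //.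
  exact/ltW/normc_cis5_lt1.
case=> -[z|].
  (* Odd k, where P dominates, excludes every finite limit z: here |Q| <= 2, so
     the form is at least |P| - 2 |z| >= |P| / 2, and the four entries add up to
     at most 3 |P|. *)
  apply: (@not_general_limit _ _ _ _ 6) => // N0.
  have [n0 h] := two_cos5_golden (6 + 4 * normc z) N0.
  pose k := (2 * n0).+1; have [N [nN a0 a1 b0 b1]] := K_near k.
  have [_] := tower_conv_mod5 k; rewrite [odd k]/= oddM /= => hc.
  have [] := h k _ _ hc; first by rewrite /k; lia.
  rewrite -addnS in a0 a1 b1 => N0n G; exists N; first exact: leq_trans nN.
  have /pow_le1 h3 : (3 * C (5 * k + 4) %% 5)%N \in [:: 2; 3]%N.
    by move: hc; rewrite !inE; lia.
  have /andP[h30 h31] := h3 (5 * k + 3)%N.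
  rewrite /cf_form /hom mulr1.
  rewrite -/(Knum y N) -/(Knum y N.+1) -/(Kden y N) -/(Kden y N.+1).
  have := normcB (z * Kden y N.+1) (z * Kden y N.+1 - Knum y N.+1).
  have -> : z * Kden y N.+1 - (z * Kden y N.+1 - Knum y N.+1) = Knum y N.+1 by ring.
  rewrite normcM; set F := normc (_ - _).
  move: a0 a1 b0 b1 h30 h31 G; rewrite !ler_norml.
  have := normc_ge0 z; have := normc_ge0 (Kden y N.+1).
  set Z := normc z; set g := _ ^+ _; set g' := _ ^+ _.
  move: (normc (Kden y N.+1)) (normc (Kden y N)) => d1 d0.
  move: (normc (Knum y N)) (normc (Knum y N.+1)) => m0 m1.
  move=> d1_0 Z0 /andP[a1 a2] /andP[a3 a4] b0 /andP[b1 b2] h0 h1 G hF.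
  have : Z * d1 <= Z * 2 by rewrite ler_wpM2l //; lra.
  move=> hZ; split; lra.
(* Even k, where Q dominates, excludes the limit at infinity. *)
apply: (@not_general_limit _ _ _ _ 6) => // N0.
have [n0 h] := two_cos5_golden 6 N0.
pose k := (2 * n0)%N; have [N [nN a0 a1 b0 b1]] := K_near k.
have [_] := tower_conv_mod5 k; rewrite oddM /= => hc.
have h3 : (3 * C (5 * k + 4) %% 5)%N \in [:: 1; 4]%N.
  by move: hc; rewrite !inE; lia.
have [] := h k _ _ h3; first by rewrite /k; lia.
rewrite -addnS in a0 a1 b1 => N0n G; exists N; first exact: leq_trans nN.
have /andP[h30 h31] := pow_le1 _ (5 * k + 3)%N hc.
rewrite /cf_form /hom mul1r mulr0 subr0.
rewrite -/(Knum y N) -/(Knum y N.+1) -/(Kden y N) -/(Kden y N.+1).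
move: a0 a1 b0 b1 h30 h31 G; rewrite !ler_norml.
set g := _ ^+ _; set g' := _ ^+ _.
move: (normc (Kden y N.+1)) (normc (Kden y N)) => d1 d0.
move: (normc (Knum y N)) (normc (Knum y N.+1)) => m0 m1.
move=> /andP[a1 a2] /andP[a3 a4] b0 /andP[b1 b2] h0 h1 G.
by split; lra.
Qed.

End Main.

Theorem corollary4 (R : realType) (t : R)
    (ht : 0 < t < 1)
    (ht_irr : irrational t)
    (ht_cf : has_regular_cf tower_quotient t) :
  ~ K_converges_generally (expc ((2 * pi * t) *i)%C).
Proof. by rewrite expc_imag; exact: K_diverges. Qed.
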